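(* Let $W$ be an admissible operator space, let $V$ be an operator subspace of $W$, and let $E\in\mathcal E_W(V)$. Let $\mathcal L_E=\{\psi\circ E:\psi\in\mathcal M_W(V)\}$. Then $$\mathcal L_E=\{F\in\mathcal E_W(V):p_F=p_E\}=\{F\in\mathcal E_W(V):\ker(F)=\ker(E)\},$$ and $\mathcal L_E$ is a convex set and a minimal non-empty left ideal in the semigroup $\mathcal M_W(V)$ of $V$-maps. Moreover, every minimal non-empty left ideal in $\mathcal M_W(V)$ is equal to $\mathcal L_{E'}$ for some $E'\in\mathcal E_W(V)$. Finally, if $F_1,F_2\in\mathcal L_E$, then $F_1+F_2=F_1\circ F_2+F_2\circ F_1$.
   Context: For operator spaces $V\subseteq W$, a $V$-map is a completely contractive (linear) map $\phi:W\to W$ with $\phi(v)=v$ for all $v\in V$. $\mathcal M_W(V)$ is the set of all $V$-maps, a semigroup under composition. Each $V$-map induces a seminorm $p_\phi(w)=\|\phi(w)\|$ on $W$; these are ordered pointwise. $W$ is admissible if for every operator subspace $V$ of $W$ and every $V$-map $\phi$ there is a $V$-map $\psi$ with $p_\psi\le p_\phi$ and $p_\psi$ minimal among all $p_\eta$, $\eta$ a $V$-map. $\mathcal E_W(V)$ is the set of minimal $V$-projections, i.e. $V$-maps $E$ with $p_E$ minimal (such $E$ are automatically idempotent). A left ideal of a semigroup $S$ is a subset $J$ with $SJ\subseteq J$. *)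

(* Defs.v *)
From HB Require Import structures.
From mathcomp Require Import all_boot all_order all_algebra.
From mathcomp Require Import all_classical all_reals convex.
From mathcomp Require Export complex.

Set Implicit Arguments.
Unset Strict Implicit.
Unset Printing Implicit Defensive.

Import Order.TTheory GRing.Theory Num.Theory.

Local Open Scope classical_set_scope.
Local Open Scope ring_scope.

Definition l2norm (R : realType) (n : nat) (x : 'cV[R[i]]_n) : R :=
  Num.sqrt (\sum_i Normc.normc (x i 0) ^+ 2).

Definition opnorm (R : realType) (m n : nat) (a : 'M[R[i]]_(m, n)) : R :=
  sup [set l2norm (a *m x) | x in [set x | l2norm x <= 1]].

(* Products of a scalar matrix and a matrix over a module, on either side:
   [mulmx] requires both matrices to have entries in the same ring. *)
Definition lmulmx (K : pzRingType) (W : lmodType K) (m n p : nat)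
    (a : 'M[K]_(m, n)) (x : 'M[W]_(n, p)) : 'M[W]_(m, p) :=
  \matrix_(i, j) \sum_k a i k *: x k j.

Definition rmulmx (K : pzRingType) (W : lmodType K) (m n p : nat)
    (x : 'M[W]_(m, n)) (b : 'M[K]_(n, p)) : 'M[W]_(m, p) :=
  \matrix_(i, j) \sum_k b k j *: x i k.

(* Abstract operator spaces (Ruan): a complex vector space with a norm on each
   'M[W]_n, subject to the two axioms [mxnorm_block] and [mxnorm_mul].
   Completeness is not required. *)
HB.mixin Record isOperatorSpace (R : realType) W of GRing.Lmodule R[i] W := {
  mxnorm : forall n : nat, 'M[W]_n -> R ;
  mxnorm_eq0 : forall n (x : 'M[W]_n), mxnorm n x = 0 -> x = 0 ;
  mxnormD : forall n (x y : 'M[W]_n),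
    mxnorm n (x + y) <= mxnorm n x + mxnorm n y ;
  mxnormZ : forall n (c : R[i]) (x : 'M[W]_n),
    mxnorm n (map_mx (GRing.scale c) x) = Normc.normc c * mxnorm n x ;
  mxnorm_block : forall m n (x : 'M[W]_m) (y : 'M[W]_n),
    mxnorm (m + n)%N (block_mx x 0 0 y) = Num.max (mxnorm m x) (mxnorm n y) ;
  mxnorm_mul : forall m n (a : 'M[R[i]]_(n, m)) (x : 'M[W]_m)
      (b : 'M[R[i]]_(m, n)),
    mxnorm n (rmulmx (lmulmx a x) b) <= opnorm a * mxnorm m x * opnorm b
}.

#[short(type="operatorSpaceType")]
HB.structure Definition OperatorSpace (R : realType) :=
  {W of isOperatorSpace R W & GRing.Lmodule R[i] W}.

Definition osnorm (R : realType) (W : operatorSpaceType R) (w : W) : R :=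
  mxnorm 1 (const_mx w : 'M[W]_1).

Definition completely_contractive (R : realType) (W : operatorSpaceType R)
    (phi : W -> W) : Prop :=
  forall (n : nat) (x : 'M[W]_n), mxnorm n (map_mx phi x) <= mxnorm n x.

Definition operator_subspace (R : realType) (W : operatorSpaceType R)
    (V : set W) : Prop :=
  submod_closed (mem V : {pred W}).

Definition Vmaps (R : realType) (W : operatorSpaceType R) (V : set W) :
    set (W -> W) :=
  [set phi | [/\ linear phi, completely_contractive phi &
                 forall v, V v -> phi v = v]].

Definition pnorm (R : realType) (W : operatorSpaceType R) (phi : W -> W) :
    W -> R :=
  fun w => osnorm (phi w).

Definition pnorm_minimal (R : realType) (W : operatorSpaceType R) (V : set W)
    (phi : W -> W) : Prop :=
  forall eta, Vmaps V eta ->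
    (forall w, pnorm eta w <= pnorm phi w) -> pnorm eta = pnorm phi.

Definition admissible (R : realType) (W : operatorSpaceType R) : Prop :=
  forall V : set W, operator_subspace V ->
  forall phi, Vmaps V phi ->
  exists psi, [/\ Vmaps V psi, forall w, pnorm psi w <= pnorm phi w &
                  pnorm_minimal V psi].

Definition minimal_Vprojections (R : realType) (W : operatorSpaceType R)
    (V : set W) : set (W -> W) :=
  [set E | Vmaps V E /\ pnorm_minimal V E].

Definition left_ideal (T : Type) (op : T -> T -> T) (S J : set T) : Prop :=
  J `<=` S /\ forall s j, S s -> J j -> J (op s j).

Definition minimal_left_ideal (T : Type) (op : T -> T -> T) (S J : set T) :
    Prop :=
  [/\ left_ideal op S J, J !=set0 &
      forall I, left_ideal op S I -> I !=set0 -> I `<=` J -> I = J].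

Definition Lideal (R : realType) (W : operatorSpaceType R) (V : set W)
    (E : W -> W) : set (W -> W) :=
  [set psi \o E | psi in Vmaps V].

Definition ker (R : realType) (W : operatorSpaceType R) (phi : W -> W) :
    set W :=
  [set w | phi w = 0].

Definition fcomp (T : Type) (f g : T -> T) : T -> T := f \o g.

(* Main.v *)
Require Import Defs.
From mathcomp Require Import all_boot all_order all_algebra.
From mathcomp Require Import all_classical all_reals convex interval_inference.

(** Everything rests on one fact: a minimal V-projection [E] is idempotent.
    The averages [A_n = (E + E^2 + ... + E^n) / n] are again V-maps, with
    [||A_n w|| <= ||E w||], so minimality of [E] turns this into an equality.
    At [w - E w] the sum telescopes to [A_n (w - E w) = (E w - E^(n+1) w) / n],
    of norm at most [2 ||w|| / n]; hence [E (w - E w) = 0]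
    ([minimal_idempotent]).

    If [psi] is a V-map and [E] is minimal, then [psi \o E] has seminorm below
    that of [E], hence equal to it, and so is minimal too ([comp_minimal]).
    Thus the members of [Lideal V E] are minimal V-projections with the same
    seminorm as [E], and a fortiori the same kernel.  If [G] is idempotent, then
    [w - G w] lies in [ker G], so [F \o G = F] as soon as [ker G] is contained
    in [ker F] ([comp_ker_sub]).  Hence every minimal V-projection [F] with the
    kernel of [E] is [F \o E], a member of [Lideal V E]; and [F1 \o F2 = F1],
    [F2 \o F1 = F2] for [F1], [F2] in [Lideal V E], whence the last formula.

    The identity [E = E \o F] for [F] in [Lideal V E] shows that any
    left ideal containing such an [F] contains [E], so [Lideal V E] is a minimal
    left ideal.  For an arbitrary minimal left ideal [J] and [j] in [J], the
    map [E \o j \o E] equals [E] ([minimal_sandwich]); from this [E \o j], which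
    belongs to [J], is a minimal V-projection ([comp_minimal_r]), and it
    generates [J]. *)

Import Order.TTheory GRing.Theory Num.Theory.

Local Open Scope classical_set_scope.
Local Open Scope ring_scope.

(** * The norm of an operator space *)

Lemma normc_ge0 (R : realType) (z : R[i]) : 0 <= Normc.normc z.
Proof. by case: z => a b; exact: sqrtr_ge0. Qed.

Lemma ger0_normcE (R : realType) (z : R[i]) :
  0 <= z -> (Normc.normc z)%:C%C = z.
Proof. by move=> z0; rewrite -[RHS](ger0_norm z0). Qed.

Lemma normc_onem (R : realType) (t : R[i]) : 0 <= t <= 1 ->
  Normc.normc t + Normc.normc (1 - t) = 1.
Proof.
move=> /andP[t0 t1]; apply: (@complexI R).
by rewrite rmorphD /= !ger0_normcE ?subr_ge0// addrC subrK.
Qed.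

Section OperatorSpaceNorm.
Context {R : realType} {W : operatorSpaceType R}.
Implicit Types (v w : W) (f g : W -> W).

Lemma osnormD v w : osnorm (v + w) <= osnorm v + osnorm w.
Proof.
have -> : osnorm (v + w) = mxnorm 1 (const_mx v + const_mx w : 'M[W]_1).
  by congr mxnorm; apply/matrixP => i j; rewrite !mxE.
exact: mxnormD.
Qed.

Lemma osnormZ (c : R[i]) w : osnorm (c *: w) = Normc.normc c * osnorm w.
Proof.
by rewrite /osnorm -mxnormZ; congr mxnorm; apply/matrixP => i j; rewrite !mxE.
Qed.

Lemma osnorm0 : osnorm (0 : W) = 0.
Proof. by rewrite -(scale0r (0 : W)) osnormZ Normc.normc0 mul0r. Qed.

Lemma osnormN w : osnorm (- w) = osnorm w.
Proof.
rewrite -scaleN1r osnormZ -[RHS]mul1r; congr (_ * _).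
by rewrite /= sqrrN expr1n oppr0 expr0n addr0 sqrtr1.
Qed.

Lemma osnorm_ge0 w : 0 <= osnorm w.
Proof.
have := osnormD w (- w); rewrite subrr osnorm0 osnormN -mulr2n.
by rewrite pmulrn_lge0.
Qed.

Lemma osnorm_eq0 w : osnorm w = 0 -> w = 0.
Proof. by move/mxnorm_eq0/matrixP/(_ 0 0); rewrite !mxE. Qed.

Lemma osnorm_conv (t : R[i]) v w : 0 <= t <= 1 ->
  osnorm v <= osnorm w -> osnorm (t *: v + (1 - t) *: w) <= osnorm w.
Proof.
move=> t01 vw; apply: le_trans (osnormD _ _) _; rewrite !osnormZ.
rewrite -[leRHS]mul1r -(normc_onem _ _ t01) mulrDl lerD2r.
by rewrite ler_wpM2l ?normc_ge0.
Qed.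

Lemma osnorm_contractive f w :
  completely_contractive f -> osnorm (f w) <= osnorm w.
Proof. by move=> /(_ 1%N (const_mx w)); rewrite map_const_mx. Qed.

Lemma linear_sub f : linear f -> {morph f : v w / v - w}.
Proof. by move=> lf v w; rewrite addrC -scaleN1r lf scaleN1r addrC. Qed.

Lemma completely_contractive_conv (t : R[i]) f g : 0 <= t <= 1 ->
  completely_contractive f -> completely_contractive g ->
  completely_contractive (fun w => t *: f w + (1 - t) *: g w).
Proof.
move=> t01 cf cg n x.
rewrite [map_mx _ x](_ : _ = map_mx (GRing.scale t) (map_mx f x) +
                       map_mx (GRing.scale (1 - t)) (map_mx g x)); last first.
  by apply/matrixP => i j; rewrite !mxE.
apply: le_trans (mxnormD _ _ _) _; rewrite !mxnormZ.
rewrite -[leRHS]mul1r -(normc_onem _ _ t01) mulrDl.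
by apply: lerD; apply: ler_wpM2l; rewrite ?normc_ge0.
Qed.

(** The idempotent [g] kills every [w - g w], hence so does [f]. *)
Lemma comp_ker_sub f g : linear f -> linear g -> g \o g = g ->
  ker g `<=` ker f -> f \o g = f.
Proof.
move=> lf lg gg gf; apply/funext => w /=.
have /gf/= : ker g (w - g w).
  by rewrite /ker/= linear_sub// -[g (g w)]/((g \o g) w) gg subrr.
by rewrite /ker/= linear_sub// => /eqP; rewrite subr_eq0 eq_sym => /eqP.
Qed.

Lemma pnorm_le_ker f g : (forall w, pnorm f w <= pnorm g w) ->
  ker g `<=` ker f.
Proof.
move=> fg w gw; apply: osnorm_eq0; apply: le_anti; rewrite osnorm_ge0 andbT.
by apply: le_trans (fg w) _; rewrite /pnorm gw osnorm0.
Qed.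

Lemma eq_pnorm_ker f g : pnorm f = pnorm g -> ker f = ker g.
Proof.
by move=> fg; apply/seteqP; split; apply: pnorm_le_ker => w; rewrite fg.
Qed.

End OperatorSpaceNorm.

(** * V-maps and minimal V-projections *)

Section VMaps.
Context {R : realType} {W : operatorSpaceType R} (V : set W).
Implicit Types (w : W) (E F phi psi : W -> W).

Lemma Vmaps_comp phi psi : Vmaps V phi -> Vmaps V psi -> Vmaps V (phi \o psi).
Proof.
move=> [lf cf Vf] [lg cg Vg]; split.
- by move=> a x y /=; rewrite lg lf.
- by move=> n x; rewrite map_mx_comp; exact: le_trans (cf _ _) (cg _ _).
- by move=> v Vv /=; rewrite Vg// Vf.
Qed.

Lemma Vmaps_conv (t : R[i]) phi psi : 0 <= t <= 1 ->
  Vmaps V phi -> Vmaps V psi ->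
  Vmaps V (fun w => t *: phi w + (1 - t) *: psi w).
Proof.
move=> t01 [lf cf Vf] [lg cg Vg]; split.
- move=> a x y /=; rewrite lf lg !scalerDr !scalerA addrACA.
  by rewrite (mulrC t) (mulrC (1 - t)).
- exact: completely_contractive_conv.
- by move=> v Vv /=; rewrite Vf// Vg// -scalerDl addrC subrK scale1r.
Qed.

Lemma pnorm_comp phi psi w : Vmaps V phi -> pnorm (phi \o psi) w <= pnorm psi w.
Proof. by case=> _ cf _; exact: (osnorm_contractive phi). Qed.

(** The map [A] is the average of [E, E^2, ..., E^(n+1)] and [B] is [E^(n+2)].
    Writing the next average as the convex combination of [E] and [A \o E] with
    weights [1/(n+2)] and [(n+1)/(n+2)] makes the telescoping inductive. *)
Lemma Vmaps_averages E n : Vmaps V E ->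
  exists A B, [/\ Vmaps V A, Vmaps V B,
    forall w, pnorm A w <= pnorm E w &
    forall w, n.+1%:R *: A (w - E w) = E w - B w].
Proof.
move=> ME; have [lE _ _] := ME.
elim: n => [|n [A [B [MA MB AE telA]]]].
  exists E, (E \o E); split=> //; first exact: Vmaps_comp.
  by move=> w; rewrite scale1r linear_sub.
set k : R[i] := n.+2%:R; have k_gt0 : 0 < k by rewrite ltr0Sn.
have t01 : 0 <= k^-1 <= 1 by rewrite invr_ge0 ltW//= invf_le1// ler1n.
have t01' : 0 <= 1 - k^-1 <= 1.
  by case/andP: t01 => t0 t1; rewrite subr_ge0 t1/= gerBl.
exists (fun w => (1 - k^-1) *: A (E w) + (1 - (1 - k^-1)) *: E w), (B \o E).
split.
- by apply: Vmaps_conv => //; exact: Vmaps_comp.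
- exact: Vmaps_comp.
- move=> w; apply: osnorm_conv => //.
  exact: le_trans (AE (E w)) (pnorm_comp E E w ME).
- move=> w; rewrite scalerDr !scalerA subKr mulfV ?gt_eqF// scale1r.
  rewrite mulrBr mulr1 mulfV ?gt_eqF//.
  have -> : k - 1 = n.+1%:R by rewrite /k -[n.+2]addn1 natrD addrK.
  by rewrite !(linear_sub E)// telA addrC addrA subrK.
Qed.

(** The averages of [E] cannot have a smaller seminorm than [E], but they tend
    to [0] at every [w - E w]. *)
Lemma minimal_idempotent E : minimal_Vprojections V E -> E \o E = E.
Proof.
move=> [ME minE]; have [lE cE _] := ME; apply/funext => w /=.
suff /osnorm_eq0 : osnorm (E (w - E w)) = 0.
  by rewrite linear_sub// => /eqP; rewrite subr_eq0 eq_sym => /eqP.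
set e := osnorm _; apply/eqP; apply: contrapT => /negP e0.
have e_gt0 : 0 < e by rewrite lt_neqAle eq_sym e0 osnorm_ge0.
have bound n : n%:R * e <= osnorm w + osnorm w.
  case: n => [|n]; first by rewrite mul0r addr_ge0 ?osnorm_ge0.
  have [A [B [MA [_ cB _] AE telA]]] := Vmaps_averages E n ME.
  have -> : e = osnorm (A (w - E w)).
    by rewrite -[RHS]/(pnorm A (w - E w)) (minE _ MA AE).
  have -> : n.+1%:R * osnorm (A (w - E w)) = osnorm (n.+1%:R *: A (w - E w)).
    rewrite osnormZ; congr (_ * _); apply: (@complexI R).
    by rewrite ger0_normcE ?ler0n// rmorph_nat.
  rewrite telA; apply: le_trans (osnormD _ _) _; rewrite osnormN.
  by apply: lerD; exact: osnorm_contractive.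
pose m := Num.truncn ((osnorm w + osnorm w) / e).
have := truncnS_gt ((osnorm w + osnorm w) / e).
by rewrite ltr_pdivrMr// ltNge bound.
Qed.

(** Composing with a contraction can only lower the seminorm of [E], which is
    already minimal. *)
Lemma comp_minimal E psi : minimal_Vprojections V E -> Vmaps V psi ->
  minimal_Vprojections V (psi \o E) /\ pnorm (psi \o E) = pnorm E.
Proof.
move=> [ME minE] Mpsi; have MpE := Vmaps_comp _ _ Mpsi ME.
have pE : pnorm (psi \o E) = pnorm E.
  by apply: minE => // w; exact: pnorm_comp.
by split=> //; split=> // eta Meta; rewrite pE => le_eta; exact: minE.
Qed.

Lemma minimal_comp_ker E F : minimal_Vprojections V E ->
  minimal_Vprojections V F -> ker E = ker F -> E \o F = E.
Proof.
move=> mE mF EF; have [[lE _ _] _] := mE; have [[lF _ _] _] := mF.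
apply: comp_ker_sub => //; first exact: minimal_idempotent.
by rewrite EF.
Qed.

Lemma Lideal_minimal E F : minimal_Vprojections V E -> Lideal V E F ->
  minimal_Vprojections V F /\ pnorm F = pnorm E.
Proof. by move=> mE [psi Mpsi <-]; exact: comp_minimal. Qed.

Lemma Lideal_ker E F : minimal_Vprojections V E -> Lideal V E F ->
  ker F = ker E.
Proof. by move=> mE /(Lideal_minimal _ _ mE)[_ /eq_pnorm_ker]. Qed.

Lemma ker_Lideal E F : minimal_Vprojections V E -> minimal_Vprojections V F ->
  ker F = ker E -> Lideal V E F.
Proof. by move=> mE mF FE; exists F; [case: mF|exact: minimal_comp_ker]. Qed.

Lemma LidealE_pnorm E : minimal_Vprojections V E ->
  Lideal V E = [set F | minimal_Vprojections V F /\ pnorm F = pnorm E].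
Proof.
move=> mE; apply/seteqP; split=> F; first exact: Lideal_minimal.
by move=> [mF /eq_pnorm_ker]; exact: ker_Lideal.
Qed.

Lemma LidealE_ker E : minimal_Vprojections V E ->
  Lideal V E = [set F | minimal_Vprojections V F /\ ker F = ker E].
Proof.
move=> mE; apply/seteqP; split=> F; last by case=> mF; exact: ker_Lideal.
move=> LF; split; last exact: Lideal_ker LF.
by have [] := Lideal_minimal _ _ mE LF.
Qed.

Lemma Lideal_comp E F G : minimal_Vprojections V E ->
  Lideal V E F -> Lideal V E G -> F \o G = F.
Proof.
move=> mE LF LG; apply: minimal_comp_ker.
- by have [] := Lideal_minimal _ _ mE LF.
- by have [] := Lideal_minimal _ _ mE LG.
- by rewrite (Lideal_ker _ _ mE LF) (Lideal_ker _ _ mE LG).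
Qed.

(** * Left ideals of the semigroup of V-maps *)

Lemma Lideal_left_ideal E : Vmaps V E ->
  left_ideal (@fcomp W) (Vmaps V) (Lideal V E).
Proof.
move=> ME; split; first by move=> _ [psi Mpsi <-]; exact: Vmaps_comp.
by move=> s _ Ms [psi Mpsi <-]; exists (s \o psi) => //; exact: Vmaps_comp.
Qed.

Lemma Lideal_id E : minimal_Vprojections V E -> Lideal V E E.
Proof. by move=> mE; apply: ker_Lideal. Qed.

Lemma Lideal_sub_left_ideal E (J : set (W -> W)) :
  left_ideal (@fcomp W) (Vmaps V) J -> J E -> Lideal V E `<=` J.
Proof. by move=> [_ idJ] JE _ [psi Mpsi <-]; exact: idJ. Qed.

Lemma Lideal_minimal_left_ideal E : minimal_Vprojections V E ->
  minimal_left_ideal (@fcomp W) (Vmaps V) (Lideal V E).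
Proof.
move=> mE; have ME := mE.1; split; first exact: Lideal_left_ideal.
  by exists E; exact: Lideal_id.
move=> I idI [F IF] IL; apply/seteqP; split=> //.
apply: Lideal_sub_left_ideal => //.
rewrite -(Lideal_comp _ _ _ mE (Lideal_id _ mE) (IL _ IF)).
exact: idI.2.
Qed.

Lemma Lideal_convex E : Vmaps V E ->
  convex_set (Lideal V E : set (convex_lmodType (W -> W))).
Proof.
move=> ME _ _ t /set_mem[f Mf <-] /set_mem[g Mg <-]; apply: mem_set.
exists (fun w => t%:num *: f w + (1 - t%:num) *: g w) => //.
by apply: Vmaps_conv => //; rewrite ge0 le1.
Qed.

(** As [F := E \o phi \o E] lies in [Lideal V E], one has [E \o F = E]; but
    [E] is idempotent, so that [E \o F = F]. *)
Lemma minimal_sandwich E phi : minimal_Vprojections V E -> Vmaps V phi ->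
  E \o phi \o E = E.
Proof.
move=> mE Mphi; have EE := minimal_idempotent _ mE.
have L : Lideal V E (E \o phi \o E).
  by exists (E \o phi) => //; apply: Vmaps_comp => //; exact: mE.1.
rewrite -[RHS](Lideal_comp _ _ _ mE (Lideal_id _ mE) L).
apply/funext => w; exact/esym/(congr1 (fun f : W -> W => f (phi (E w))) EE).
Qed.

(** Since [E \o phi] is idempotent, a V-map [eta] with a smaller seminorm equals
    [(eta \o E) \o phi], and [eta \o E] has the seminorm of [E]. *)
Lemma comp_minimal_r E phi : minimal_Vprojections V E -> Vmaps V phi ->
  minimal_Vprojections V (E \o phi).
Proof.
move=> mE Mphi; have MEphi := Vmaps_comp _ _ mE.1 Mphi.
split=> // eta Meta le_eta.
have idem : (E \o phi) \o (E \o phi) = E \o phi.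
  by rewrite compA (minimal_sandwich _ _ mE Mphi).
have eta_abs : eta \o (E \o phi) = eta.
  apply: comp_ker_sub => //; [by case: Meta|by case: MEphi|].
  exact: pnorm_le_ker.
have [_ pE] := comp_minimal _ _ mE Meta.
rewrite -eta_abs; apply/funext => w.
exact: (congr1 (fun p : W -> R => p (phi w)) pE).
Qed.

Lemma minimal_left_ideal_Lideal E (J : set (W -> W)) :
  minimal_Vprojections V E -> minimal_left_ideal (@fcomp W) (Vmaps V) J ->
  exists2 E', minimal_Vprojections V E' & J = Lideal V E'.
Proof.
move=> mE [idJ [j Jj] minJ]; have Mj := idJ.1 _ Jj.
have mE' := comp_minimal_r _ _ mE Mj.
exists (E \o j) => //; apply/esym/minJ.
- by apply: Lideal_left_ideal; exact: mE'.1.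
- by exists (E \o j); exact: Lideal_id.
- by apply: Lideal_sub_left_ideal => //; apply: idJ.2 => //; exact: mE.1.
Qed.

End VMaps.

(* MathComp-Analysis. *)
Theorem theorem2p12 (R : realType) (W : operatorSpaceType R) (V : set W)
    (E : W -> W) :
  admissible W ->
  operator_subspace V ->
  minimal_Vprojections V E ->
  [/\ Lideal V E =
        [set F | minimal_Vprojections V F /\ pnorm F = pnorm E],
      [set F | minimal_Vprojections V F /\ pnorm F = pnorm E] =
        [set F | minimal_Vprojections V F /\ ker F = ker E],
      (* over R[i], [0 <= t <= 1] forces t to be real *)
      convex_set (Lideal V E : set (convex_lmodType (W -> W))) /\
      minimal_left_ideal (@fcomp W) (Vmaps V) (Lideal V E),
      forall J : set (W -> W),
        minimal_left_ideal (@fcomp W) (Vmaps V) J ->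
        exists2 E', minimal_Vprojections V E' & J = Lideal V E' &
      forall F1 F2 : W -> W, Lideal V E F1 -> Lideal V E F2 ->
        F1 \+ F2 = (F1 \o F2) \+ (F2 \o F1)].
Proof.
move=> _ _ mE; split.
- exact: LidealE_pnorm.
- by rewrite -LidealE_pnorm// LidealE_ker.
- split; first by apply: Lideal_convex; exact: mE.1.
  exact: Lideal_minimal_left_ideal.
- by move=> J; exact: minimal_left_ideal_Lideal mE.
- by move=> F1 F2 L1 L2; rewrite !(Lideal_comp _ _ _ _ mE).
Qed.
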